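(* Let $k\ge 2$ and $n\ge 0$ be integers and let $P=U^{k-1}DUD^{k-1}$. Let $d_n(P)$ be the number of Dyck paths of semilength $n$ avoiding the pattern $P$, let $C_n$ be the $n$-th Catalan number, and let $b_{i,j}$ be the ballot numbers. Then: (i) $d_n(P)=C_n$ if $n<k$; (ii) $d_n(P)=C_n-1$ if $n=k$; (iii) if $n>k$ and $n\ge 2k-3$, then $d_n(P)=C_{k-1}^2$; (iv) if $n\ge k+1$, then $$d_n(P)=\left(\sum_{j=0}^{n-k+1}b_{k-2,j}\right)^2+\sum_{j\ge 2}b_{k-j,\,n-k+j}^2,$$ where the last sum vanishes when $n\ge 2k-3$; (v) by the ballot number recurrence $b_{i+1,j}=\sum_{s=0}^{j}b_{i,s}$, if $n\ge k+1$, then $$d_n(P)=\sum_{j\ge 1}b_{k-j,\,n-k+j}^2.$$ In particular, $d_n(UUDUDD)=4$ when $n\ge 3$.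
   Context: A Dyck path of semilength $n$ is a word of length $2n$ on the alphabet $\{U,D\}$ with $n$ letters $U$ and $n$ letters $D$ in which every prefix contains at least as many $U$'s as $D$'s. A Dyck path $Q$ contains the pattern $P$ (another Dyck path) if $P$ is a (not necessarily contiguous) subword, i.e. subsequence, of $Q$; otherwise $Q$ avoids $P$. A Dyck prefix is a word on $\{U,D\}$ all of whose prefixes contain at least as many $U$'s as $D$'s. The ballot number $b_{i,j}$ is the number of Dyck prefixes with exactly $i$ letters $U$ and $j$ letters $D$ ($i\ge j\ge 0$); terms $b_{i,j}$ with indices outside this range count no prefixes and are zero. The Catalan numbers are $C_n=\frac{1}{n+1}\binom{2n}{n}$.
   Formalization: Clause (v) is stated only for k+1 ≤ n ≤ 2k−2, since for n ≥ 2k−1 its right side is 0 while d_n(P)=C_{k-1}^2>0 (e.g. k=2, n=3: 1 versus 0); the recurrence b_{i+1,j}=Σ_{s≤j} b_{i,s} is likewise stated only for j ≤ i+1, where it is true. *)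

(* Defs.v *)
From mathcomp Require Import all_boot.

Set Implicit Arguments.
Unset Strict Implicit.
Unset Printing Implicit Defensive.

Definition U : bool := true.
Definition D : bool := false.

Definition dyck_prefix (w : seq bool) : bool :=
  [forall m : 'I_(size w).+1,
     count_mem D (take m w) <= count_mem U (take m w)].

Definition dyck_path (n : nat) (w : seq bool) : bool :=
  [&& dyck_prefix w, count_mem U w == n & count_mem D w == n].

(* [subseq] is the not necessarily contiguous subword order. *)
Definition avoids (P Q : seq bool) : bool := ~~ subseq P Q.

Definition num_avoiding (n : nat) (P : seq bool) : nat :=
  #|[set w : (2 * n).-tuple bool | dyck_path n w && avoids P w]|.

(* A genuine count for all natural i, j; in particular it is 0 when i < j,
   so b_{i+1,j} = \sum_(s <= j) b_{i,s} holds only for j <= i + 1. *)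
Definition ballot (i j : nat) : nat :=
  #|[set w : (i + j).-tuple bool |
      [&& dyck_prefix w, count_mem U w == i & count_mem D w == j]]|.

Definition catalan (n : nat) : nat := 'C(2 * n, n) %/ n.+1.

(* The division above is exact. *)
Lemma catalanE (n : nat) : n.+1 * catalan n = 'C(2 * n, n).
Proof.
have E : n.+1 * 'C(2 * n, n.+1) = n * 'C(2 * n, n).
  by rewrite mul_bin_left mul2n -addnn addnK.
have dvd : n.+1 %| 'C(2 * n, n).
  have : n.+1 %| n.+1 * 'C(2 * n, n) by rewrite dvdn_mulr.
  by rewrite mulSn dvdn_addl // -E dvdn_mulr.
by rewrite mulnC divnK.
Qed.

(* U^(k-1) D U D^(k-1), for k >= 1. *)
Definition pattern (k : nat) : seq bool :=
  nseq (k - 1) U ++ [:: D; U] ++ nseq (k - 1) D.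

(* \sum_(j >= m) b_{k-j, n-k+j}^2.  The terms with j > k have the negative
   first index k - j, hence vanish, so the sum stops at j = k; for n >= k the
   subtractions below are then never truncated. *)
Definition ballot_sq_tail (k n m : nat) : nat :=
  \sum_(m <= j < k.+1) ballot (k - j) (n - k + j) ^ 2.

(* Main.v *)
Require Import Defs.
From mathcomp Require Import all_boot zify.

(** Put r = k - 1 and cut a Dyck path w of semilength n at its middle. If the
  first half has fewer than r letters U, then w avoids P: after its r-th U
  there are fewer than r letters D. Such paths are pairs of Dyck prefixes of
  length n with the same number u < r of letters U, which gives the sum of
  squares. Otherwise the shortest prefix h with r letters U and the shortest
  suffix h' with r letters D do not overlap, and w avoids P exactly when the
  factor between them avoids DU, i.e. is of the form U^a D^b. Here a and b are
  determined by h' and h, which can be chosen independently of each other, and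
  removing the last U of h leaves a prefix counted by a ballot number
  b_{k-2,j}. *)

Set Implicit Arguments.
Unset Strict Implicit.
Unset Printing Implicit Defensive.

Local Notation cU := (count_mem U).
Local Notation cD := (count_mem D).

(** * Counting binary words *)

(** Plain sequences replace tuples, so that words of different lengths can be cut, joined and
    compared without casts. *)
Fixpoint words (N : nat) : seq (seq bool) :=
  if N is M.+1 then map (cons U) (words M) ++ map (cons D) (words M)
  else [:: [::]].

Definition nwords (N : nat) (P : pred (seq bool)) : nat := count P (words N).

Lemma mem_words (N : nat) (w : seq bool) : (w \in words N) = (size w == N).
Proof.
elim: N w => [|N IH] [|b w] //=; rewrite mem_cat.
- by apply/negP => /orP [] /mapP [].
rewrite eqSS -IH; case: b.
- rewrite mem_map; last by move=> ? ? [].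
  by rewrite orbC; case: mapP => // -[] ? _ [].
- rewrite [X in _ || X]mem_map; last by move=> ? ? [].
  by case: mapP => // -[] ? _ [].
Qed.

Lemma words_uniq (N : nat) : uniq (words N).
Proof.
elim: N => //= N IH; rewrite cat_uniq !map_inj_uniq ?IH /=; try by move=> ? ? [].
by rewrite andbT; apply/hasPn => _ /mapP [x _ ->]; apply/mapP => -[].
Qed.

Lemma card_tuple_words (N : nat) (P : pred (seq bool)) :
  #|[set w : N.-tuple bool | P w]| = nwords N P.
Proof.
rewrite cardsE cardE size_filter -enumT -(count_map val P).
apply/permP/uniq_perm; last 2 first.
- exact: words_uniq.
- move=> w; rewrite mem_words; apply/mapP/eqP => [[t _ ->]|sw]; first exact: size_tuple.
  by exists (tcast sw (in_tuple w)); rewrite ?mem_enum //= val_tcast.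
by rewrite map_inj_uniq ?enum_uniq //; exact: val_inj.
Qed.

Lemma nwords_pred0 (N : nat) (P : pred (seq bool)) :
  (forall w, size w = N -> ~~ P w) -> nwords N P = 0.
Proof.
move=> H; apply/eqP; rewrite -leqn0 leqNgt -has_count; apply/hasPn => w.
by rewrite mem_words => /eqP /H.
Qed.

Lemma eq_nwords (N : nat) (P Q : pred (seq bool)) :
  (forall w, size w = N -> P w = Q w) -> nwords N P = nwords N Q.
Proof. by move=> E; apply: eq_in_count => w; rewrite mem_words => /eqP /E. Qed.

(** The maps have to be mutually inverse only on the counted words; their values elsewhere are
    arbitrary. *)
Lemma nwords_bij (N M : nat) (P Q : pred (seq bool)) (f g : seq bool -> seq bool) :
  (forall w, size w = N -> P w -> [/\ size (f w) = M, Q (f w) & g (f w) = w]) ->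
  (forall w, size w = M -> Q w -> [/\ size (g w) = N, P (g w) & f (g w) = w]) ->
  nwords N P = nwords M Q.
Proof.
move=> Hf Hg; rewrite /nwords -!size_filter -(size_map f).
apply/perm_size/uniq_perm; last first.
- move=> w; rewrite mem_filter mem_words; apply/mapP/andP.
    move=> [v]; rewrite mem_filter mem_words => /andP [Pv /eqP sv] ->.
    by have [-> ->] := Hf v sv Pv.
  move=> [Qw /eqP sw]; have [sg Pg fg] := Hg w sw Qw.
  by exists (g w); rewrite // mem_filter mem_words sg Pg eqxx.
- by rewrite filter_uniq ?words_uniq.
rewrite map_inj_in_uniq ?filter_uniq ?words_uniq // => v w.
rewrite !mem_filter !mem_words => /andP [Pv /eqP sv] /andP [Pw /eqP sw] E.
by have [_ _ <-] := Hf v sv Pv; have [_ _ <-] := Hf w sw Pw; rewrite E.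
Qed.

Lemma nwordsS (N : nat) (P : pred (seq bool)) :
  nwords N.+1 P = nwords N (fun w => P (U :: w)) + nwords N (fun w => P (D :: w)).
Proof. by rewrite /nwords /= count_cat !count_map. Qed.

Lemma nwords_rcons (N : nat) (P : pred (seq bool)) :
  nwords N.+1 P = nwords N (fun w => P (rcons w U)) + nwords N (fun w => P (rcons w D)).
Proof.
have nrev M Q : nwords M Q = nwords M (fun w => Q (rev w)).
  by apply: (@nwords_bij _ _ _ _ rev rev) => w sw Pw; rewrite size_rev !revK.
rewrite nrev nwordsS; congr (_ + _); rewrite nrev;
  by apply: eq_nwords => w _; rewrite rev_cons revK.
Qed.

Lemma nwords_cat (N M : nat) (P Q : pred (seq bool)) :
  nwords (N + M) (fun w => P (take N w) && Q (drop N w)) = nwords N P * nwords M Q.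
Proof.
elim: N P => [|N IH] P.
  rewrite add0n /(nwords 0) /= addn0.
  under eq_nwords => w _ do rewrite take0 drop0.
  case: (P _); rewrite ?mul1n //=; exact: count_pred0.
by rewrite addSn !nwordsS mulnDl -!IH.
Qed.

Lemma nwords_split (N : nat) (P Q : pred (seq bool)) :
  nwords N P = nwords N (fun w => P w && Q w) + nwords N (fun w => P w && ~~ Q w).
Proof.
by rewrite /nwords; elim: (words N) => //= w s ->; case: (P w); case: (Q w) => /=; lia.
Qed.

Lemma nwords_partition (N K : nat) (P : pred (seq bool)) (c : seq bool -> nat) :
  (forall w, size w = N -> P w -> c w < K) ->
  nwords N P = \sum_(0 <= j < K) nwords N (fun w => P w && (c w == j)).
Proof.
move=> H; elim: K P H => [|K IH] P H.
  rewrite big_nil; apply: nwords_pred0 => w sw.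
  by apply/negP => /(H w sw).
rewrite (nwords_split N P (fun w => c w == K)) big_nat_recr //= addnC; congr (_ + _).
rewrite IH => [|w sw /andP [/(H w sw) + /eqP]]; last by lia.
apply: eq_big_nat => j /= ltj; apply: eq_nwords => w _.
by case: eqVneq => [->|]; rewrite ?andbF ?andbT //; case: eqVneq => // E; lia.
Qed.

Lemma nwords_pred1 (v : seq bool) : nwords (size v) (pred1 v) = 1.
Proof. by rewrite /nwords count_uniq_mem ?words_uniq // mem_words eqxx. Qed.

(** * Ballot numbers *)

Lemma size_count (w : seq bool) : size w = cU w + cD w.
Proof. by elim: w => //= -[] w ->; rewrite /U /D /=; lia. Qed.

Lemma dyck_prefixP (w : seq bool) :
  reflect (forall m, cD (take m w) <= cU (take m w)) (dyck_prefix w).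
Proof.
apply: (iffP forallP) => H m; last exact: H.
case: (leqP m (size w)) => [lem|ltm]; first exact: (H (Ordinal (lem : m < (size w).+1))).
have := H ord_max; rewrite /= take_size take_oversize //; exact: ltnW.
Qed.

Lemma dyck_prefix_count (w : seq bool) : dyck_prefix w -> cD w <= cU w.
Proof. by move=> /dyck_prefixP /(_ (size w)); rewrite take_size. Qed.

Lemma dyck_prefix_catl (v w : seq bool) : dyck_prefix (v ++ w) -> dyck_prefix v.
Proof.
move=> /dyck_prefixP H; apply/dyck_prefixP => m.
case: (leqP m (size v)) => [lem|ltm]; first by have := H m; rewrite takel_cat.
by have := H (size v); rewrite take_size_cat // take_oversize // ltnW.
Qed.

Lemma dyck_prefix_rcons (w : seq bool) (b : bool) :
  dyck_prefix (rcons w b) = dyck_prefix w && (cD (rcons w b) <= cU (rcons w b)).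
Proof.
apply/idP/andP => [H|[/dyck_prefixP H1 H2]].
  by split; [move: H; rewrite -cats1 => /dyck_prefix_catl | exact: dyck_prefix_count].
apply/dyck_prefixP => m; case: (leqP m (size w)) => ltm.
  by rewrite -cats1 takel_cat.
by rewrite take_oversize // size_rcons.
Qed.

Lemma dyck_prefix_catU (w : seq bool) (a : nat) :
  dyck_prefix (w ++ nseq a U) = dyck_prefix w.
Proof.
elim: a => [|a IH]; first by rewrite cats0.
rewrite -addn1 nseqD catA cats1 dyck_prefix_rcons IH andb_idr //.
rewrite -IH => /dyck_prefix_count; rewrite -cats1 !(count_cat _ (w ++ _)) /U /D /=; lia.
Qed.

Definition is_ballot (i j : nat) (w : seq bool) : bool :=
  [&& dyck_prefix w, cU w == i & cD w == j].

Lemma ballotE (i j N : nat) : N = i + j -> ballot i j = nwords N (is_ballot i j).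
Proof. by move->; exact: (card_tuple_words _ (is_ballot i j)). Qed.

Lemma ballot_gt (i j : nat) : i < j -> ballot i j = 0.
Proof.
move=> ltij; rewrite (ballotE erefl); apply: nwords_pred0 => w _.
by apply/negP => /and3P [/dyck_prefix_count + /eqP + /eqP]; lia.
Qed.

Lemma ballotS0 (i : nat) : ballot i.+1 0 = ballot i 0.
Proof.
rewrite !(ballotE erefl) addSn nwords_rcons -[RHS]addn0; congr (_ + _); last first.
  apply: nwords_pred0 => w _.
  by rewrite /is_ballot -cats1 !count_cat /U /D /=; lia.
apply: eq_nwords => w _; rewrite /is_ballot dyck_prefix_rcons -cats1 !count_cat /U /D /=.
by case: dyck_prefix; lia.
Qed.

(** Removal of the last letter. The bound matters: at $j=i+1$ the left side is 0, whereas
    $b_{i+1,i+1}$ is not. *)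
Lemma ballotSS (i j : nat) : j <= i ->
  ballot i.+1 j.+1 = ballot i j.+1 + ballot i.+1 j.
Proof.
move=> leji; rewrite (ballotE (N := (i + j).+2)); last by lia.
rewrite nwords_rcons.
rewrite !(ballotE (N := (i + j).+1)); try by lia.
congr (_ + _); apply: eq_nwords => w _;
  rewrite /is_ballot dyck_prefix_rcons -cats1 !count_cat /U /D /=;
  by case: dyck_prefix; lia.
Qed.

Lemma ballotSl (i j : nat) : j <= i.+1 ->
  ballot i.+1 j = \sum_(0 <= s < j.+1) ballot i s.
Proof.
elim: j => [|j IH] leji; first by rewrite big_nat1 ballotS0.
by rewrite big_nat_recr //= -IH ?ballotSS 1?addnC //; apply: ltnW.
Qed.

(** The closed form known from the reflection principle, written additively to avoid truncated
    subtraction. It is proved by induction: both sides obey Pascal's recurrence, and they agree on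
    the column $j=0$ and on the line $j=i+1$, where the ballot number is 0 and the binomials are
    equal by symmetry. *)
Lemma ballot_reflection (i j : nat) : j <= i.+1 ->
  ballot i j + 'C(i + j, i.+1) = 'C(i + j, i).
Proof.
have Hdiag m : ballot m m.+1 + 'C(m + m.+1, m.+1) = 'C(m + m.+1, m).
  by rewrite ballot_gt // -bin_sub ?leq_addl // addnK.
have Hcol m : ballot m 0 + 'C(m + 0, m.+1) = 'C(m + 0, m).
  rewrite addn0 binn bin_small ?leqnn // addn0.
  elim: m => [|m <-]; last by rewrite ballotS0.
  by rewrite (ballotE erefl) /nwords /= /is_ballot (introT (dyck_prefixP [::])).
elim: i j => [|i IHi] j.
  by case: j => [|[|]].
elim: j => [|j IHj] leji; first exact: Hcol.
move: (leji); rewrite ltnS leq_eqVlt => /predU1P [->|ltji]; first exact: Hdiag.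
have := IHi j.+1 ltji; have := IHj (ltnW leji).
rewrite ballotSS // !addnS !addSn !(binS (i + j).+1); lia.
Qed.

Lemma ballot_catalan (n : nat) : ballot n n = catalan n.
Proof.
apply/eqP; rewrite -(eqn_pmul2l (ltn0Sn n)) catalanE; apply/eqP.
have := ballot_reflection (leqnSn n); rewrite addnn -mul2n.
have := mul_bin_left (2 * n) n; nia.
Qed.

(** * The mirror involution *)

(** The reflection of a lattice path in a vertical line; it turns suffixes into prefixes. *)
Definition mirror (w : seq bool) : seq bool := rev (map negb w).

Lemma mirrorK : involutive mirror.
Proof. by move=> w; rewrite /mirror map_rev revK mapK //; exact: negbK. Qed.

Lemma size_mirror (w : seq bool) : size (mirror w) = size w.
Proof. by rewrite size_rev size_map. Qed.

Lemma mirror_cat (v w : seq bool) : mirror (v ++ w) = mirror w ++ mirror v.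
Proof. by rewrite /mirror map_cat rev_cat. Qed.

Lemma mirror_nseq (a : nat) (b : bool) : mirror (nseq a b) = nseq a (~~ b).
Proof. by rewrite /mirror map_nseq rev_nseq. Qed.

Lemma count_mirror (b : bool) (w : seq bool) :
  count_mem b (mirror w) = count_mem (~~ b) w.
Proof.
by rewrite count_rev count_map; apply: eq_count => c /=; case: b; case: c.
Qed.

Lemma subseq_mirror (v w : seq bool) : subseq (mirror v) (mirror w) = subseq v w.
Proof.
have H x y : subseq x y -> subseq (mirror x) (mirror y).
  by move=> /(map_subseq negb); rewrite subseq_rev.
by apply/idP/idP => /H; rewrite ?mirrorK.
Qed.

Lemma dyck_path_mirror (n : nat) (w : seq bool) :
  dyck_path n w -> dyck_path n (mirror w).
Proof.
move=> /and3P [/dyck_prefixP Hp /eqP HU /eqP HD].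
rewrite /dyck_path !count_mirror HU HD eqxx !andbT; apply/dyck_prefixP => m.
rewrite take_rev count_rev count_rev -map_drop size_map.
have Em b v : count_mem b (map negb v) = count_mem (~~ b) v.
  by rewrite count_map; apply: eq_count => c /=; case: b; case: c.
(* In a balanced word, the excess of [D] in a suffix equals the excess of [U] in the complementary
   prefix. *)
rewrite !Em; have := Hp (size w - m).
have := cat_take_drop (size w - m) w => /(congr1 (fun v => (cU v, cD v))).
by rewrite !count_cat HU HD => -[]; rewrite /U /D /=; lia.
Qed.

(** The two equations say that the whole word is balanced. A balanced word is a Dyck path exactly
    when its first part read forwards and its second part read backwards stay nonnegative. *)
Lemma dyck_path_cat_mirror (n : nat) (v w : seq bool) :
  cU v + cD w = n -> cD v + cU w = n ->
  dyck_path n (v ++ mirror w) = dyck_prefix v && dyck_prefix w.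
Proof.
move=> HU HD; apply/idP/andP => [H|[Hv /dyck_prefixP Hw]].
  split; first by case/and3P: H => /dyck_prefix_catl.
  by move: H => /dyck_path_mirror; rewrite mirror_cat mirrorK => /and3P [/dyck_prefix_catl].
rewrite /dyck_path !count_cat !count_mirror /U /D /= HU HD !eqxx !andbT.
apply/dyck_prefixP => m; rewrite take_cat; case: ifP => _.
  exact: (dyck_prefixP _ Hv).
set p := m - size v; have := cat_take_drop p (mirror w).
have -> : drop p (mirror w) = mirror (take (size w - p) w).
  by rewrite /mirror drop_rev size_map map_take.
move=> /(congr1 (fun v => (cU v, cD v))); have := Hw (size w - p).
rewrite !count_cat !count_mirror; move: HU HD; rewrite /U /D /= => HU HD Hp [].
by lia.
Qed.

(** * Cutting a word after its r-th letter U *)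

(** The letter [b] is subtracted as a number, so only [U] lowers the counter. If there are fewer
    than [r] letters [U], then [upto] is the whole word and [after] is empty. *)
Fixpoint upto (r : nat) (w : seq bool) : seq bool :=
  match w, r with
  | b :: v, _.+1 => b :: upto (r - b) v
  | _, _ => [::]
  end.

Fixpoint after (r : nat) (w : seq bool) : seq bool :=
  match w, r with
  | b :: v, _.+1 => after (r - b) v
  | _, _ => w
  end.

Lemma upto_after (r : nat) (w : seq bool) : upto r w ++ after r w = w.
Proof. by elim: w r => [|b w IH] [|r] //=; rewrite IH. Qed.

Lemma count_upto (r : nat) (w : seq bool) : r <= cU w -> cU (upto r w) = r.
Proof.
elim: w r => [|b w IH] [|r] //= H; rewrite IH; move: H; case: b; rewrite /U /=; lia.
Qed.

Lemma upto_cat (r : nat) (v w : seq bool) : r <= cU v -> upto r (v ++ w) = upto r v.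
Proof.
elim: v r => [|b v IH] [|r] //=; first by case: w.
by move=> H; rewrite IH //; move: H; case: b; rewrite /U /=; lia.
Qed.

Lemma after_cat (r : nat) (v w : seq bool) :
  r <= cU v -> after r (v ++ w) = after r v ++ w.
Proof.
elim: v r => [|b v IH] [|r] //=; first by case: w.
by move=> H; rewrite IH //; move: H; case: b; rewrite /U /=; lia.
Qed.

Lemma upto_upto (r : nat) (w : seq bool) : upto r (upto r w) = upto r w.
Proof. by elim: w r => [|b w IH] [|r] //=; rewrite IH. Qed.

Lemma after_upto (r : nat) (w : seq bool) : after r (upto r w) = [::].
Proof. by elim: w r => [|b w IH] [|r] //=; rewrite IH. Qed.

Lemma upto_lastU (r : nat) (w : seq bool) :
  r < cU w -> exists v, upto r.+1 w = rcons v U.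
Proof.
elim: w r => //= -[] w IH [|r]; rewrite /U /= => H.
- by exists [::]; case: (w).
- by have [|v ->] := IH r; [move: H; rewrite /U; lia | exists (U :: v)].
- by have [|v ->] := IH 0; [move: H; rewrite /U; lia | exists (D :: v)].
- by have [|v ->] := IH r.+1; [move: H; rewrite /U; lia | exists (D :: v)].
Qed.

Lemma after_catU (v w : seq bool) : after (cU v).+1 (v ++ U :: w) = w.
Proof.
by elim: v => [|[] v IH] //=; case: w.
Qed.

Lemma leq_count_take (r m : nat) (w : seq bool) : r <= cU w ->
  (r <= cU (take m w)) = (size (upto r w) <= m).
Proof.
elim: w r m => [|b w IH] [|r] [|m] //= H.
rewrite ltnS -IH; last by move: H; case: b; rewrite /U /=; lia.
by case: b {H}; rewrite /U /=; lia.
Qed.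

(** Greedy matching: the leftmost occurrence of $U^r$ leaves the longest remainder for [v]. *)
Lemma subseq_nseqU (r : nat) (v w : seq bool) :
  subseq (nseq r U ++ v) w = (r <= cU w) && subseq v (after r w).
Proof.
elim: w r => [|b w IH] [|r] //=; case: b; rewrite /U /=.
  by rewrite IH subSS subn0.
by rewrite -[true :: _]/(nseq r.+1 U ++ v) IH.
Qed.

Lemma subseqDU_nseq (a b : nat) : ~~ subseq [:: D; U] (nseq a U ++ nseq b D).
Proof.
elim: a => //=; apply/negP => /mem_subseq /(_ U).
by rewrite mem_nseq andbF => /(_ isT).
Qed.

Lemma avoidDU_nseq (w : seq bool) : ~~ subseq [:: D; U] w ->
  w = nseq (cU w) U ++ nseq (cD w) D.
Proof.
elim: w => //= -[] w IH /= H; first by rewrite {1}IH.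
rewrite sub1seq in H; have U0 := count_memPn H.
have Ew : w = nseq (size w) D.
  by apply/all_pred1P/allP => -[] //= Uw; rewrite Uw in H.
by move: (size_count w); rewrite U0 !add0n /= => <-; rewrite -Ew.
Qed.

(** Greedy matching from both ends: $U^r$ is placed leftmost, then $D^r$ rightmost by passing to the
    mirror image. The word $DU$ is its own mirror image, so it is sought in the mirrored middle
    factor. *)
Lemma subseq_pattern (r : nat) (w : seq bool) :
  subseq (pattern r.+1) w =
  [&& r <= cU w, r <= cD (after r w)
    & subseq [:: D; U] (after r (mirror (after r w)))].
Proof.
rewrite /pattern subn1 /= subseq_nseqU; congr (_ && _).
rewrite -[LHS]subseq_mirror -[D :: U :: _]/([:: D; U] ++ nseq r D) mirror_cat.
by rewrite mirror_nseq subseq_nseqU count_mirror.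
Qed.

(** * Splitting and gluing Dyck paths *)

(** The last condition is minimality: no proper prefix of [h] has [r] letters [U]. *)
Definition is_head (r : nat) (h : seq bool) : bool :=
  [&& dyck_prefix h, cU h == r & upto r h == h].

(** A head followed by letters [U] only; heads of varying length thus become words of one fixed
    length, which [nwords] can count. *)
Definition is_padded_head (r : nat) (w : seq bool) : bool :=
  [&& dyck_prefix w, r <= cU w & cD (after r w) == 0].

Definition pad (n : nat) (h : seq bool) : seq bool := h ++ nseq (n - size h) U.

(* The lengths of the padding are exchanged between the two halves, so as to
  make the numbers of U and D equal; as a consequence the middle of the path
  need not be where the halves meet. *)
Definition glue (n : nat) (h h' : seq bool) : seq bool :=
  (h ++ nseq (n - size h') U) ++ mirror (h' ++ nseq (n - size h) U).

Lemma mirror_glue (n : nat) (h h' : seq bool) : mirror (glue n h h') = glue n h' h.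
Proof. by rewrite /glue mirror_cat mirrorK. Qed.

Lemma countD_nseqU (a : nat) : cD (nseq a U) = 0.
Proof. by rewrite count_nseq. Qed.

Lemma countU_nseqU (a : nat) : cU (nseq a U) = a.
Proof. by rewrite count_nseq /= mul1n. Qed.

(** With [pad_headP], this makes [pad n] a bijection from heads of length at most [n] to padded
    heads of length [n]. *)
Lemma upto_padded_head (n r : nat) (w : seq bool) :
  size w = n -> is_padded_head r w ->
  [/\ is_head r (upto r w), size (upto r w) <= n & pad n (upto r w) = w].
Proof.
move=> sw /and3P [Hp Hr /eqP HD]; have Ew := upto_after r w.
have Ea : after r w = nseq (size (after r w)) U.
  apply/all_pred1P/allP => -[] // Dw.
  by move/eqP: HD; rewrite -leqn0 leqNgt -has_count has_pred1 Dw.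
have Es : size (upto r w) + size (after r w) = n by rewrite -size_cat Ew.
split; [|by lia|].
  rewrite /is_head upto_upto count_upto // !eqxx !andbT.
  by move: Hp; rewrite -{1}Ew => /dyck_prefix_catl.
by rewrite /pad -Es addKn -Ea.
Qed.

Lemma pad_headP (n r : nat) (h : seq bool) : is_head r h -> size h <= n ->
  [/\ size (pad n h) = n, is_padded_head r (pad n h) & upto r (pad n h) = h].
Proof.
move=> /and3P [Hp /eqP HU /eqP Hh] Hs; rewrite /pad.
have Hr : r <= cU h by rewrite HU.
split; first by rewrite size_cat size_nseq subnKC.
  rewrite /is_padded_head dyck_prefix_catU Hp count_cat HU leq_addr after_cat //=.
  by rewrite -{1}Hh after_upto countD_nseqU.
by rewrite upto_cat.
Qed.

(** The last condition keeps the shortest suffix with [r] letters [D] disjoint from the shortest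
    prefix with [r] letters [U]. *)
Definition avoids_late (n r : nat) (w : seq bool) : bool :=
  dyck_path n w && avoids (pattern r.+1) w && (r <= cD (after r w)).

(** Let [h], [h'] be the two heads and $U^aD^b$ the middle factor. Counting the letters [U] of [w]
    gives [r + a + cD h' = n], so [a = n - size h']; counting [D] gives [b = n - size h]. Hence the
    heads determine [w]. *)
Lemma avoids_lateP (n r : nat) (w : seq bool) :
  r <= n -> avoids_late n r w ->
  [/\ is_head r (upto r w) /\ is_head r (upto r (mirror w)),
      size (upto r w) <= n, size (upto r (mirror w)) <= n
    & glue n (upto r w) (upto r (mirror w)) = w].
Proof.
move=> lern /andP [/andP [Hd Ha] Hr].
have /and3P [Hp /eqP HU /eqP HD] := Hd.
have /and3P [Hp' _ _] := dyck_path_mirror Hd.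
move: Ha; rewrite /avoids subseq_pattern HU lern Hr /=.
set t := after r w in Hr *; set h := upto r w; set z := after r _ => Hz.
have Ew : w = h ++ t by rewrite upto_after.
have HrU : r <= cU (mirror t) by rewrite count_mirror.
have -> : upto r (mirror w) = upto r (mirror t) by rewrite Ew mirror_cat upto_cat.
set h' := upto r (mirror t).
have Et : mirror t = h' ++ z by rewrite upto_after.
have Uh : cU h = r by rewrite count_upto ?HU.
have Uh' : cU h' = r by rewrite count_upto.
have Hh : dyck_prefix h by move: Hp; rewrite Ew => /dyck_prefix_catl.
have Hh' : dyck_prefix h'.
  by move: Hp'; rewrite Ew mirror_cat Et -catA => /dyck_prefix_catl.
have Ez : mirror z = nseq (cU (mirror z)) U ++ nseq (cD (mirror z)) D.
  by apply: avoidDU_nseq; rewrite -[[:: D; U]]/(mirror [:: D; U]) subseq_mirror.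
have Ew' : w = h ++ mirror z ++ mirror h'.
  by rewrite -mirror_cat -Et mirrorK.
have := congr1 cU Ew'; have := congr1 cD Ew'; rewrite HU HD !count_cat.
rewrite [cU (mirror h')]count_mirror [cD (mirror h')]count_mirror -[~~ U]/D -[~~ D]/U Uh Uh' => ED EU.
have := size_count h; have := size_count h'; rewrite Uh Uh' => Sh' Sh.
split; [|by lia|by lia|].
  by rewrite /is_head Uh Uh' Hh Hh' !upto_upto !eqxx.
rewrite [RHS]Ew' Ez /glue mirror_cat mirror_nseq !catA.
by do 3?congr (_ ++ _); congr nseq; lia.
Qed.

Lemma upto_glue (n r : nat) (h h' : seq bool) : is_head r h -> upto r (glue n h h') = h.
Proof.
by move=> /and3P [_ /eqP HU /eqP Hh]; rewrite /glue -catA upto_cat // HU.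
Qed.

(** What remains between the two heads is a block of [U] followed by a block of [D], so greedy
    matching finds no $DU$ there. *)
Lemma glueP (n r : nat) (h h' : seq bool) :
  is_head r h -> is_head r h' -> size h <= n -> size h' <= n ->
  size (glue n h h') = 2 * n /\ avoids_late n r (glue n h h').
Proof.
move=> /and3P [Hp /eqP HU /eqP Hh] /and3P [Hp' /eqP HU' /eqP Hh'] Hs Hs'.
have := size_count h; have := size_count h'; rewrite HU HU' => Sh' Sh.
split.
  by rewrite /glue !(size_cat, size_mirror) !size_nseq; lia.
have Hr : r <= cU h by rewrite HU.
have Hr' : r <= cU h' by rewrite HU'.
have E : after r (glue n h h') =
    mirror (h' ++ nseq (n - size h) U ++ nseq (n - size h') D).
  rewrite /glue -catA after_cat // -{1}Hh after_upto /= !mirror_cat.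
  by rewrite !mirror_nseq -catA.
rewrite /avoids_late /avoids subseq_pattern E mirrorK after_cat //.
rewrite (_ : after r h' = [::]); last by rewrite -Hh' after_upto.
rewrite cat0s (negbTE (subseqDU_nseq _ _)) !andbF andbT count_mirror count_cat HU' leq_addr.
rewrite andbT /glue dyck_path_cat_mirror ?dyck_prefix_catU ?Hp //.
  by rewrite !count_cat countD_nseqU countU_nseqU HU; lia.
by rewrite !count_cat countD_nseqU countU_nseqU HU'; lia.
Qed.

(** Such paths correspond to ordered pairs of heads of length at most [n]. Padding both heads
    encodes the pair as one word of length [2 * n] with independent halves, hence the square. *)
Lemma nwords_avoids_late (n r : nat) : r <= n ->
  nwords (2 * n) (avoids_late n r) = nwords n (is_padded_head r) ^ 2.
Proof.
move=> lern; rewrite -mulnn -nwords_cat.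
apply: (@nwords_bij _ _ _ _
  (fun w => pad n (upto r w) ++ pad n (upto r (mirror w)))
  (fun w => glue n (upto r (take n w)) (upto r (drop n w)))) => w sw.
  move=> /(avoids_lateP lern) [[H H'] Hs Hs' Eg].
  have [s1 p1 u1] := pad_headP H Hs; have [s2 p2 u2] := pad_headP H' Hs'.
  by rewrite size_cat take_size_cat // drop_size_cat // s1 s2 p1 p2 u1 u2.
have st : size (take n w) = n by rewrite size_takel // sw leq_addr.
have sd : size (drop n w) = n by rewrite size_drop sw addnK.
move=> /andP [/(upto_padded_head st) [H Hs E] /(upto_padded_head sd) [H' Hs' E']].
have [sg pg] := glueP H H' Hs Hs'.
by rewrite mirror_glue !upto_glue // E E' cat_take_drop.
Qed.

(** With [j] letters [D], the head has length [r + 1 + j]. Cutting off its last [U] together with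
    the padding leaves a Dyck prefix with [r] letters [U] and [j] letters [D]. *)
Lemma nwords_padded_head (n r : nat) : r < n ->
  nwords n (is_padded_head r.+1) = \sum_(0 <= j < (n - r.+1).+1) ballot r j.
Proof.
move=> ltrn; rewrite (@nwords_partition n (n - r.+1).+1 _ cD); last first.
  by move=> w sw /and3P [_ HU _]; have := size_count w; rewrite sw; lia.
apply: eq_big_nat => j /= ltj; rewrite (ballotE erefl).
apply: (@nwords_bij _ _ _ _ (take (r + j)) (fun v => v ++ nseq (n - (r + j)) U)) => w sw.
  move=> /andP [Hw /eqP HD]; have [Hh Hs Ep] := upto_padded_head sw Hw.
  case/and3P: Hw => _ Hr _; case/and3P: Hh => Hh /eqP Uh _.
  have [v Ev] := upto_lastU Hr.
  have Dh : cD (upto r.+1 w) = j by rewrite -HD -{2}Ep count_cat countD_nseqU addn0.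
  move: Uh Dh Hh Hs Ep; rewrite Ev -cats1 !count_cat -[cU [:: U]]/1 -[cD [:: U]]/0 => Uv Dv Hh Hs Ep.
  have sv : size v = r + j by rewrite size_count; lia.
  move: Ep; rewrite /pad size_cat sv -catA => <-; rewrite take_size_cat //.
  rewrite /is_ballot (dyck_prefix_catl Hh); split; [by [] | by lia |].
  by congr (_ ++ _); rewrite -[RHS]/(nseq (n - (r + j + 1)).+1 U); congr nseq; move: Hs; rewrite size_cat sv /=; lia.
move=> /and3P [Hp /eqP HU /eqP HD].
(* At least one [U] is appended: the first one completes the head, the others are padding. *)
have Ea : n - (r + j) = (n - (r + j)).-1.+1 by lia.
split; first by rewrite size_cat size_nseq sw; lia.
  rewrite /is_padded_head dyck_prefix_catU Hp !count_cat countD_nseqU countU_nseqU HU HD.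
  by rewrite addn0 eqxx andbT Ea -HU after_catU countD_nseqU; lia.
by rewrite -sw take_size_cat.
Qed.

(* Both sides say that the shortest prefix with r letters U has length at most n. *)
Lemma leq_countD_after (n r : nat) (w : seq bool) : r <= n -> dyck_path n w ->
  (r <= cD (after r w)) = (r <= cU (take n w)).
Proof.
move=> lern /and3P [_ /eqP HU /eqP HD]; rewrite leq_count_take ?HU //.
have := congr1 cD (upto_after r w); rewrite count_cat HD size_count count_upto ?HU //.
by lia.
Qed.

(** Cut at the middle and mirror the second half. Both halves [x], [y] have length [n], and
    [cU x + cD y = n] forces [cU x = cU y]. *)
Lemma nwords_dyck_early (n r : nat) : r <= n.+1 ->
  nwords (2 * n) (fun w => dyck_path n w && (cU (take n w) < r))
  = \sum_(0 <= u < r) ballot u (n - u) ^ 2.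
Proof.
move=> lern; rewrite (@nwords_partition _ r _ (fun w => cU (take n w))); last first.
  by move=> w _ /andP [].
apply: eq_big_nat => u /= ltu; rewrite -mulnn (@ballotE _ _ n); last by lia.
rewrite -nwords_cat.
(* On words of length [2 * n] this is an involution, so it serves as both directions of the
   bijection. *)
pose f w := take n w ++ mirror (drop n w).
have fK w : size w = n + n -> f (f w) = w.
  move=> sw; have st : size (take n w) = n by rewrite size_takel // sw leq_addr.
  by rewrite /f take_size_cat // drop_size_cat // mirrorK cat_take_drop.
apply: (@nwords_bij _ _ _ _ f f) => w sw.
  rewrite mul2n -addnn in sw *.
  have st : size (take n w) = n by rewrite size_takel // sw leq_addr.
  have sd : size (drop n w) = n by rewrite size_drop sw addnK.
  move=> /andP [/andP [Hd _] /eqP Hu]; split; last exact: fK.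
    by rewrite size_cat size_mirror st sd.
  rewrite /f take_size_cat // drop_size_cat //.
  have sm : size (mirror (drop n w)) = n by rewrite size_mirror.
  have Ew : w = take n w ++ mirror (mirror (drop n w)) by rewrite mirrorK cat_take_drop.
  move: Ew Hu st sm; move: (take n w) (mirror (drop n w)) => x y Ew Hu sx sy.
  move: Hd; rewrite Ew => Hd; have /and3P [_ /eqP HU /eqP HD] := Hd.
  move: HU HD; rewrite !count_cat !count_mirror -[~~ U]/D -[~~ D]/U => HU HD.
  move: Hd; rewrite dyck_path_cat_mirror // => /andP [Hx Hy].
  have := size_count x; have := size_count y; rewrite sx sy => Sx Sy.
  move: Hu HU HD Sx Sy; rewrite /is_ballot Hx Hy.
  by set a := cU x; set b := cD x; set c := cU y; set d := cD y; lia.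
have st : size (take n w) = n by rewrite size_takel // sw leq_addr.
have sd : size (drop n w) = n by rewrite size_drop sw addnK.
move=> /andP [/and3P [P1 /eqP U1 /eqP D1] /and3P [P2 /eqP U2 /eqP D2]]; split; last exact: fK.
  by rewrite size_cat size_mirror st sd; lia.
rewrite /f dyck_path_cat_mirror ?P1 ?P2 /= ?take_size_cat // ?U1 ?D1 ?U2 ?D2; lia.
Qed.

(** * Formulas for the number of avoiding paths *)

Lemma num_avoiding_nwords (n : nat) (P : seq bool) :
  num_avoiding n P = nwords (2 * n) (fun w => dyck_path n w && avoids P w).
Proof. exact: (card_tuple_words _ (fun w => dyck_path n w && avoids P w)). Qed.

Lemma num_avoidingE (n r : nat) : r < n ->
  num_avoiding n (pattern r.+2) =
  (\sum_(0 <= j < (n - r.+1).+1) ballot r j) ^ 2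
  + \sum_(0 <= u < r.+1) ballot u (n - u) ^ 2.
Proof.
move=> ltrn; rewrite num_avoiding_nwords.
rewrite (nwords_split _ _ (fun w => r.+1 <= cD (after r.+1 w))).
rewrite (nwords_avoids_late ltrn) nwords_padded_head // -nwords_dyck_early; last by lia.
congr (_ + _); apply: eq_nwords => w _; case Hd: (dyck_path n w) => //=.
rewrite (leq_countD_after ltrn Hd) -ltnNge andbC; case: ltnP => //= Hu.
(* With too few letters [U] in the first half, too few [D] follow the [r.+1]-st [U], so avoidance is
   automatic. *)
rewrite /avoids subseq_pattern (leq_countD_after ltrn Hd) (leqNgt _ (cU (take n w))) Hu.
by rewrite andbF.
Qed.

Lemma nwords_dyck_path (n : nat) : nwords (2 * n) (dyck_path n) = catalan n.
Proof. by rewrite -ballot_catalan (@ballotE _ _ (2 * n)) // mul2n addnn. Qed.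

Lemma size_pattern (r : nat) : size (pattern r.+1) = 2 * r.+1.
Proof. by rewrite /pattern !size_cat !size_nseq /=; lia. Qed.

Lemma dyck_path_pattern (r : nat) : dyck_path r.+2 (pattern r.+2).
Proof.
have -> : pattern r.+2 = rcons (nseq r.+1 U) D ++ mirror (rcons (nseq r.+1 U) D).
  by rewrite /pattern subn1 -cats1 mirror_cat mirror_nseq -!catA.
have E : dyck_prefix (nseq r.+1 U).
  by rewrite -[nseq _ _]cat0s dyck_prefix_catU; apply/dyck_prefixP.
have HD : cD (rcons (nseq r.+1 U) D) = 1.
  by rewrite -cats1 count_cat countD_nseqU.
have HU : cU (rcons (nseq r.+1 U) D) = r.+1.
  by rewrite -cats1 count_cat countU_nseqU -[cU [:: D]]/0 addn0.
by rewrite dyck_path_cat_mirror ?dyck_prefix_rcons ?E HD HU //= addn1.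
Qed.

Lemma num_avoiding_small (n r : nat) : n <= r ->
  num_avoiding n (pattern r.+1) = catalan n.
Proof.
move=> lenr; rewrite num_avoiding_nwords -nwords_dyck_path; apply: eq_nwords => w sw.
rewrite andb_idr // => _; apply/negP => /size_subseq.
by rewrite size_pattern sw leq_pmul2l // ltnNge lenr.
Qed.

(** A path as long as the pattern contains it only by being equal to it, so exactly one Dyck path is
    excluded. *)
Lemma num_avoiding_eq (r : nat) :
  num_avoiding r.+2 (pattern r.+2) = catalan r.+2 - 1.
Proof.
rewrite num_avoiding_nwords -nwords_dyck_path.
rewrite [in RHS](nwords_split _ _ (avoids (pattern r.+2))).
suff -> : nwords (2 * r.+2) (fun w => dyck_path r.+2 w && ~~ avoids (pattern r.+2) w) = 1.
  by rewrite addnK.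
rewrite -size_pattern -[RHS](nwords_pred1 (pattern r.+2)); apply: eq_nwords => w sw /=.
rewrite negbK; apply/andP/eqP => [[_ Hs]|->]; last first.
  by rewrite dyck_path_pattern subseq_refl.
by apply/eqP; rewrite eq_sym -(size_subseq_leqif Hs) sw.
Qed.

(** The substitution $u=k-j$ with $k=r+2$. *)
Lemma ballot_sq_tail2E (n r : nat) : r.+2 <= n ->
  ballot_sq_tail r.+2 n 2 = \sum_(0 <= u < r.+1) ballot u (n - u) ^ 2.
Proof.
move=> lern; rewrite /ballot_sq_tail -[2 in LHS]add0n big_addn big_nat_rev /=.
by rewrite !subSS subn0; apply: eq_big_nat => u /= ltu; congr (ballot _ _ ^ 2); lia.
Qed.

Lemma ballot_sq_tail2_eq0 (n k : nat) : k < n -> 2 * k - 3 <= n ->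
  ballot_sq_tail k n 2 = 0.
Proof.
move=> ltkn le3; rewrite /ballot_sq_tail big_nat_cond big1 // => j /andP [/andP [H1 H2] _].
(* For $j\ge 2$, $k-j<n-k+j$ follows from $2k-4<n$. *)
by rewrite ballot_gt //; lia.
Qed.

Lemma ballot_sq_tail1E (n k : nat) : 0 < k ->
  ballot_sq_tail k n 1 = ballot (k - 1) (n - k + 1) ^ 2 + ballot_sq_tail k n 2.
Proof. by move=> lt0k; rewrite /ballot_sq_tail big_ltn. Qed.

Lemma sum_ballot_catalan (r m : nat) : r <= m ->
  \sum_(0 <= j < m.+1) ballot r j = catalan r.+1.
Proof.
(* $C_{r+1}=b_{r+1,r+1}$ is the sum of $b_{r,j}$ over $j\le r+1$; all terms with $j>r$ vanish, so
   any upper limit from [r] on gives the same sum. *)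
move=> lerm; rewrite -ballot_catalan ballotSl // [RHS]big_nat_recr //= ballot_gt // addn0.
elim: m lerm => [|m IH]; first by rewrite leqn0 => /eqP ->.
rewrite leq_eqVlt => /predU1P [-> //|ltrm].
by rewrite big_nat_recr //= IH // ballot_gt // addn0.
Qed.

Theorem mainTheorem4 :
  (forall k n : nat, 2 <= k ->
    [/\ (n < k -> num_avoiding n (pattern k) = catalan n),
        (n = k -> num_avoiding n (pattern k) = catalan n - 1),
        (k < n -> 2 * k - 3 <= n ->
          num_avoiding n (pattern k) = catalan (k - 1) ^ 2),
        (k + 1 <= n ->
          num_avoiding n (pattern k) =
            (\sum_(0 <= j < (n - k + 1).+1) ballot (k - 2) j) ^ 2
            + ballot_sq_tail k n 2
          /\ (2 * k - 3 <= n -> ballot_sq_tail k n 2 = 0))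
      & (k + 1 <= n -> n <= 2 * k - 2 ->
          num_avoiding n (pattern k) = ballot_sq_tail k n 1)])
  /\ (forall i j : nat, j <= i.+1 ->
        ballot i.+1 j = \sum_(0 <= s < j.+1) ballot i s)
  /\ (forall n : nat, 3 <= n ->
        num_avoiding n [:: U; U; D; U; D; D] = 4).
Proof.
have Hiv k n : 2 <= k -> k < n -> num_avoiding n (pattern k) =
    (\sum_(0 <= j < (n - k + 1).+1) ballot (k - 2) j) ^ 2 + ballot_sq_tail k n 2.
  case: k => [|[|r]] // _ ltkn.
  rewrite num_avoidingE; last exact: ltnW (ltnW ltkn).
  rewrite ballot_sq_tail2E; last exact: ltnW.
  by rewrite !subSS subn0 addn1 (@subnSK r.+1) // ltnW.
have Hiii k n : 2 <= k -> k < n -> 2 * k - 3 <= n ->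
    num_avoiding n (pattern k) = catalan (k - 1) ^ 2.
  move=> le2k ltkn le3; rewrite Hiv // ballot_sq_tail2_eq0 // addn0.
  rewrite sum_ballot_catalan; last by lia.
  by congr (catalan _ ^ 2); lia.
split; last split.
- move=> k n le2k; split.
  + by case: k le2k => // k _; rewrite ltnS; exact: num_avoiding_small.
  + by move=> ->; case: k le2k => [|[|r]] // _; exact: num_avoiding_eq.
  + exact: Hiii.
  + by rewrite addn1 => ltkn; split; [exact: Hiv | exact: ballot_sq_tail2_eq0].
  (* The recurrence requires $n-k+1\le k-1$, that is $n\le 2k-2$. For larger $n$ the sum of squares
     is 0, while the count is $C_{k-1}^2$. *)
  + rewrite addn1 => ltkn le2; rewrite Hiv // ballot_sq_tail1E; last exact: ltnW.
    congr (_ ^ 2 + _); have -> : k - 1 = (k - 2).+1 by lia.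
    by rewrite ballotSl //; lia.
- exact: ballotSl.
(* Here $k=3$: the value is $C_3-1=5-1$ for $n=3$ and $C_2^2=2^2$ for $n>3$. *)
- move=> n; rewrite leq_eqVlt => /predU1P [<-|lt3n].
    exact: (num_avoiding_eq 1).
  by rewrite -[_ :: _]/(pattern 3) Hiii //; lia.
Qed.
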